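(* Suppose that $\theta>0$. Let $k:=\lfloor \epsilon N\rfloor$, for each $p\in[P]$ let $q_p$ be the $(k+1)$-th largest value (counted with multiplicity) amongst $\{-\mathbf{b}_p^\top\boldsymbol{\xi}_i\}_{i\in[N]}$, and let $M>0$ be a sufficiently large constant (see context). Consider an arbitrary $\mathbf{x}\in\mathcal{X}_{\mathrm{DR}}(\mathcal{S})$. Then there exist $\mathbf{r}\in\mathbb{R}^N$, $t\in\mathbb{R}$ and $\mathbf{z}\in\{0,1\}^N$ such that \begin{align*} & t\ge0,\quad \mathbf{r}\ge\mathbf{0},\\ & \epsilon\, t \geq \theta + \frac{1}{N}\sum_{i\in[N]} r_i,\\ & M(1-z_i)\geq t-r_i, && i\in[N],\\ & \sum_{i\in[N]} z_i\leq k,\\ & \frac{\mathbf{b}_p^\top \boldsymbol{\xi}_i+d_p-\mathbf{a}_p^\top\mathbf{x}}{\|\mathbf{b}_p\|_*}+\frac{-\mathbf{b}_p^\top\boldsymbol{\xi}_i-q_p}{\|\mathbf{b}_p\|_*}\, z_i\geq t-r_i, && i\in[N],\ p\in[P], \end{align*} and such that for every $p\in[P]$, $$u_p:=\frac{-q_p+d_p-\mathbf{a}_p^\top\mathbf{x}}{\|\mathbf{b}_p\|_*}-t\ \geq\ 0.$$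
   Context: Notation: $[n]:=\{1,\dots,n\}$. Fix positive integers $K,L,N,P$, a compact set $\mathcal{X}\subset\mathbb{R}^L$, a norm $\|\cdot\|$ on $\mathbb{R}^K$ with dual norm $\|\cdot\|_*$, samples $\boldsymbol{\xi}_1,\dots,\boldsymbol{\xi}_N\in\mathbb{R}^K$, a risk tolerance $\epsilon\in(0,1)$ and a radius $\theta$. For $p\in[P]$ let $\mathbf{a}_p\in\mathbb{R}^L$, $\mathbf{b}_p\in\mathbb{R}^K\setminus\{\mathbf{0}\}$, $d_p\in\mathbb{R}$. For $\mathbf{x}\in\mathcal{X}$ the safety set is $$\mathcal{S}(\mathbf{x}):=\{\boldsymbol{\xi}\in\mathbb{R}^K:\ \mathbf{b}_p^\top\boldsymbol{\xi}+d_p-\mathbf{a}_p^\top\mathbf{x}>0,\ p\in[P]\}.$$ Let $\mathbb{P}_N$ be the empirical distribution on $\boldsymbol{\xi}_1,\dots,\boldsymbol{\xi}_N$ (mass $1/N$ on each sample). For distributions $\mathbb{P},\mathbb{P}'$ on $\mathbb{R}^K$, the 1-Wasserstein distance is $$d_W(\mathbb{P},\mathbb{P}'):=\inf_{\Pi}\{\mathbb{E}_{(\boldsymbol{\xi},\boldsymbol{\xi}')\sim\Pi}[\|\boldsymbol{\xi}-\boldsymbol{\xi}'\|]:\ \Pi\text{ has marginal distributions }\mathbb{P},\mathbb{P}'\},$$ and the ambiguity set is $\mathcal{F}_N(\theta):=\{\mathbb{P}: d_W(\mathbb{P}_N,\mathbb{P})\le\theta\}$. The feasible region of the distributionally robust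 chance-constrained program is $$\mathcal{X}_{\mathrm{DR}}(\mathcal{S}):=\Big\{\mathbf{x}\in\mathcal{X}:\ \sup_{\mathbb{P}\in\mathcal{F}_N(\theta)}\mathbb{P}[\boldsymbol{\xi}\notin\mathcal{S}(\mathbf{x})]\le\epsilon\Big\}.$$ ''$M$ sufficiently large'' means: $M>0$ and $M\ge |\mathbf{b}_p^\top\boldsymbol{\xi}_i+d_p-\mathbf{a}_p^\top\mathbf{x}|/\|\mathbf{b}_p\|_*$ for all $\mathbf{x}\in\mathcal{X}$, $i\in[N]$, $p\in[P]$. *)

(* Defs.v *)
From HB Require Import structures.
From mathcomp Require Import all_boot all_order all_algebra.
From mathcomp Require Import all_classical all_reals all_analysis.

Set Implicit Arguments.
Unset Strict Implicit.
Unset Printing Implicit Defensive.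

Import Order.TTheory GRing.Theory Num.Theory.
Import numFieldNormedType.Exports.

Local Open Scope classical_set_scope.
Local Open Scope ring_scope.

Definition dotv (R : realType) (n : nat) (u v : 'cV[R]_n) : R :=
  (u^T *m v) 0 0.

(* An arbitrary norm on R^n, unrelated to the canonical (max) norm on
   matrices. *)
Record is_norm (R : realType) (n : nat) (nu : 'cV[R]_n -> R) : Prop := IsNorm {
  is_norm_triangle : forall u v, nu (u + v) <= nu u + nu v;
  is_norm_scale : forall (c : R) u, nu (c *: u) = `|c| * nu u;
  is_norm_definite : forall u, nu u = 0 -> u = 0 }.

(* When nu is a norm the set below is nonempty and bounded, so this real
   supremum is the true one. *)
Definition dual_norm (R : realType) (n : nat) (nu : 'cV[R]_n -> R)
    (b : 'cV[R]_n) : R :=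
  sup [set dotv b v | v in [set v | nu v <= 1]].

(* Borel sigma-algebra of R^n, for the usual topology.  This type unfolds to
   'cV[R]_n, but does not carry its algebraic structures. *)
Definition borelcV (R : realType) (n : nat) :=
  g_sigma_algebraType (@open 'cV[R]_n).

Section empirical.
Context (R : realType) (n N : nat).

(* The otherwise unused positivity proof lets the probability structure below
   be inferred. *)
Definition empirical (N_gt0 : (0 < N)%N) (xi : 'I_N -> 'cV[R]_n)
    (A : set (borelcV R n)) : \bar R :=
  ((N%:R^-1)%:E * \sum_(i < N) \d_(xi i : borelcV R n) A)%E.

Context (N_gt0 : (0 < N)%N) (xi : 'I_N -> 'cV[R]_n).
Local Notation PN := (empirical N_gt0 xi).

Let empirical0 : PN set0 = 0%E.
Proof. by rewrite /empirical big1 ?mule0// => i _; rewrite measure0. Qed.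

Let empirical_ge0 A : (0 <= PN A)%E.
Proof. by rewrite mule_ge0// ?lee_fin ?invr_ge0// sume_ge0. Qed.

Let empirical_semi_sigma_additive : semi_sigma_additive PN.
Proof.
move=> F mF tF mUF; rewrite /empirical.
rewrite [X in X @ _ --> _](_ : _ = fun m => ((N%:R^-1)%:E *
    \sum_(i < N) \sum_(0 <= j < m) \d_(xi i : borelcV R n) (F j))%E); last first.
  apply/funext => m; rewrite exchange_big/= ge0_sume_distrr// => j _.
  by rewrite sume_ge0.
apply: cvgeZl => //; apply: cvg_nnesum => i _.
  by apply: nearW => m; rewrite sume_ge0.
exact: measure_semi_sigma_additive.
Qed.

HB.instance Definition _ := isMeasure.Build _ _ _ PN
  empirical0 empirical_ge0 empirical_semi_sigma_additive.

Let empirical_setT : PN setT = 1%E.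
Proof.
rewrite /empirical (eq_bigr (fun=> 1%E)); last by move=> i _; rewrite probability_setT.
rewrite sumEFin sumr_const card_ord -EFinM mulVf// pnatr_eq0 -lt0n.
exact: N_gt0.
Qed.

HB.instance Definition _ := Measure_isProbability.Build _ _ _ PN empirical_setT.

End empirical.

Section wasserstein.
Context (R : realType) (n : nat).
Local Notation T := (borelcV R n).

Definition couplings (P Q : probability T R) : set (probability (T * T)%type R) :=
  [set Pi : probability (T * T)%type R |
      (forall A : set T, measurable A -> Pi (A `*` setT) = P A) /\
      (forall B : set T, measurable B -> Pi (setT `*` B) = Q B)].

Definition wasserstein (nu : 'cV[R]_n -> R) (P Q : probability T R) : \bar R :=
  ereal_inf
    [set (\int[Pi]_z (nu ((z.1 : 'cV[R]_n) - (z.2 : 'cV[R]_n)))%:E)%E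
     | Pi in couplings P Q].

Definition ambiguity (nu : 'cV[R]_n -> R) (P0 : probability T R) (theta : R) :
    set (probability T R) :=
  [set P : probability T R | (wasserstein nu P0 P <= theta%:E)%E].

End wasserstein.

Section chance_constraint.
Context (R : realType) (K L : nat).

Definition safety_set (P : nat) (a : 'I_P -> 'cV[R]_L) (b : 'I_P -> 'cV[R]_K)
    (d : 'I_P -> R) (x : 'cV[R]_L) : set 'cV[R]_K :=
  [set xi | forall p, dotv (b p) xi + d p - dotv (a p) x > 0].

Definition feasible_DR (N : nat) (X : set 'cV[R]_L) (nu : 'cV[R]_K -> R)
    (N_gt0 : (0 < N)%N) (xi : 'I_N -> 'cV[R]_K) (eps theta : R)
    (S : 'cV[R]_L -> set 'cV[R]_K) : set 'cV[R]_L :=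
  [set x | X x /\
    (ereal_sup [set Q (~` S x : set (borelcV R K))
                | Q in ambiguity nu (empirical N_gt0 xi) theta]
       <= eps%:E)%E].

End chance_constraint.

(* [kth_largest k v] is the (k+1)-th largest of v_0, ..., v_(N-1), counted with
   multiplicity; only meaningful for k < N. *)
Definition kth_largest (R : realType) (N k : nat) (v : 'I_N -> R) : R :=
  nth 0 (sort >=%O [seq v i | i <- enum 'I_N]) k.

(* Main.v *)
(* Let w_{ip} = (b_p^T xi_i + d_p - a_p^T x) / ||b_p||_* and let
   s_i = max(0, min_p w_{ip}), the distance from xi_i to the complement of S(x).
   Moving a fraction p_i of the mass of each sample xi_i (almost) onto that
   complement shows that x being feasible forces (1/N) sum_i p_i <= eps for every
   p in [0,1]^N with (1/N) sum_i p_i s_i < theta.  Take for t the (k+1)-th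
   smallest s_i and r_i = max(t - s_i, 0).  The fractional knapsack solution
   p_i = 1 if s_i < t, p_i = al if s_i = t, and p_i = 0 otherwise satisfies
   p_i s_i = p_i t - r_i, so eps t < theta + (1/N) sum_i r_i would allow a total
   mass slightly above eps N to be moved.  Hence t > 0, and z_i = [s_i = 0] works:
   s_i < t for at most k indices, and s_i >= t implies w_{ip} >= t for all p,
   so the (k+1)-th smallest w_{ip} over i is at least t, which is u_p >= 0. *)
From HB Require Import structures.
Require Import Defs.
From mathcomp Require Import all_boot all_order all_algebra.
From mathcomp Require Import all_classical all_reals all_analysis.
From mathcomp Require Import measurable_realfun ring lra.

Import Order.TTheory GRing.Theory Num.Theory.
Import numFieldNormedType.Exports.

Local Open Scope classical_set_scope.
Local Open Scope ring_scope.

(** * Comparison of an arbitrary norm with the max norm, and dual norms *)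

Lemma mx_norm_tr (R : realType) m n (u : 'M[R]_(m, n)) : `|u^T| = `|u|.
Proof.
rewrite [LHS]/Num.norm/= [RHS]/Num.norm/= !mx_normrE.
apply/le_anti/andP; split; apply/bigmax_leP; split => [|[i j] _];
  do ?[by apply: bigmax_ge_id];
  by apply/bigmax_geP; right; exists (j, i) => //=; rewrite !mxE.
Qed.

Lemma mx_norm_coord (R : realType) m n (u : 'M[R]_(m, n)) i j : `|u i j| <= `|u|.
Proof.
rewrite [leRHS]/Num.norm/= mx_normrE.
by apply/bigmax_geP; right => /=; exists (i, j).
Qed.

Section norm_theory.
Context (R : realType) (n : nat) (nu : 'cV[R]_n -> R).
Hypothesis nu_norm : is_norm nu.

Lemma is_norm0 : nu 0 = 0.
Proof. by rewrite -(scale0r 0) (is_norm_scale nu_norm) normr0 mul0r. Qed.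

Lemma is_norm_ge0 u : 0 <= nu u.
Proof.
have := is_norm_triangle nu_norm u ((-1) *: u).
rewrite scaleN1r subrr is_norm0 -scaleN1r (is_norm_scale nu_norm) normrN1 mul1r.
by lra.
Qed.

Lemma is_norm_le_mx_norm : exists2 C, 0 <= C & forall u, nu u <= C * `|u|.
Proof.
exists (\sum_i nu (delta_mx i 0)).
  by rewrite sumr_ge0// => i _; exact: is_norm_ge0.
move=> u; rewrite mulr_suml {1}(matrix_sum_delta u).
rewrite (eq_bigr (fun i => u i 0 *: delta_mx i 0)); last first.
  by move=> i _; rewrite big_ord1.
elim/big_ind2 : _ => [|A a B b Aa Bb|i _]; first by rewrite is_norm0.
  by rewrite (le_trans (is_norm_triangle nu_norm _ _))// lerD.
by rewrite (is_norm_scale nu_norm) mulrC ler_wpM2l ?is_norm_ge0// mx_norm_coord.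
Qed.

Lemma is_norm_dist u v : `|nu u - nu v| <= nu (u - v).
Proof.
have H a b : nu a - nu b <= nu (a - b).
  by rewrite lerBlDr (le_trans _ (is_norm_triangle nu_norm _ _))// subrK.
rewrite ler_norml H andbT lerNl opprB (le_trans (H _ _))//.
by rewrite -opprB -scaleN1r (is_norm_scale nu_norm) normrN1 mul1r.
Qed.

(* Row vectors, because the library's Heine-Borel theorem is stated for them. *)
Lemma is_norm_tr_continuous : continuous (fun u : 'rV[R]_n => nu u^T).
Proof.
have [C C0 nuC] := is_norm_le_mx_norm.
move=> u; apply/(@cvgrPdist_lt _ _ _ (nbhs u) (nbhs_filter u)) => e e0; near=> v.
rewrite (le_lt_trans (is_norm_dist _ _))// (le_lt_trans (nuC _))//.
rewrite -linearB /= mx_norm_tr.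
rewrite (@le_lt_trans _ _ ((C + 1) * `|u - v|))//.
  by rewrite ler_wpM2r// lerDl.
rewrite mulrC -ltr_pdivlMr; last by lra.
near: v; apply: (@cvgrPdist_lt _ _ _ (nbhs u) _ id u).1 => //.
rewrite divr_gt0//; lra.
Unshelve. all: by end_near. Qed.

(** [nu] attains its minimum on the compact unit sphere of the max norm, and definiteness makes that
    minimum positive. *)
Lemma is_norm_ge_mx_norm : exists2 c, 0 < c & forall u, c * `|u| <= nu u.
Proof.
pose S := [set u : 'rV[R]_n | `|u| = 1].
have cS : compact S.
  apply: bounded_closed_compact.
    exists 1; split=> // M M1 u /= ->; exact: ltW.
  have -> : S = (fun u : 'rV[R]_n => `|u|) @^-1` [set x | x = 1] by [].
  apply: preimage_closed; last exact: closed_eq.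
  by move=> u _; exact: norm_continuous.
(* For [n = 0] the sphere is empty and every vector is zero, so any constant serves. *)
have [S0|S0] := pselect (S !=set0); last first.
  exists 1 => // u; rewrite mul1r.
  have [->|u0] := eqVneq u 0; first by rewrite normr0 is_norm_ge0.
  case: S0; exists (`|u|^-1 *: u)^T; rewrite /S/= mx_norm_tr.
  by rewrite normrZ normfV normr_id mulVf// normr_eq0.
have cnu := continuous_subspaceT is_norm_tr_continuous.
have [c /set_mem cS1 cmin] := compact_EVT_min S0 cS (cnu _).
exists (nu c^T).
  rewrite lt_neqAle is_norm_ge0 andbT; apply/negP => /eqP/esym.
  move=> /(is_norm_definite nu_norm) /(congr1 trmx); rewrite trmxK trmx0 => c0.
  by move: cS1; rewrite /S /= c0 normr0 => /eqP; rewrite eq_sym oner_eq0.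
move=> u; have [->|u0] := eqVneq u 0; first by rewrite normr0 mulr0 is_norm_ge0.
have un : 0 < `|u| by rewrite normr_gt0.
have := cmin (`|u|^-1 *: u)^T; rewrite trmxK (is_norm_scale nu_norm).
rewrite normfV normr_id ler_pdivlMl 1?mulrC//; apply.
rewrite inE /S/= mx_norm_tr.
by rewrite normrZ normfV normr_id mulVf// normr_eq0.
Qed.

Let dotv_le (b v : 'cV[R]_n) : dotv b v <= (\sum_i `|b i 0|) * `|v|.
Proof.
rewrite /dotv mxE mulr_suml ler_sum// => i _; rewrite mxE.
rewrite (le_trans (ler_norm _))// normrM ler_wpM2l//.
exact: mx_norm_coord.
Qed.

(** The lower comparison constant bounds the unit ball of [nu] in the max norm, hence [dotv b] on
    it. *)
Lemma has_sup_dual_norm (b : 'cV[R]_n) : has_sup [set dotv b v | v in [set v | nu v <= 1]].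
Proof.
split; first by exists (dotv b 0), 0 => //=; rewrite is_norm0.
have [c c0 cnu] := is_norm_ge_mx_norm.
exists ((\sum_i `|b i 0|) * c^-1) => _ [v /= v1 <-].
rewrite (le_trans (dotv_le _ _))// ler_wpM2l ?sumr_ge0//.
by rewrite -[c^-1]mul1r ler_pdivlMr// mulrC (le_trans (cnu v)).
Qed.

(** Testing the supremum at [b] rescaled to [nu]-norm 1 already gives a positive value. *)
Lemma dual_norm_gt0 (b : 'cV[R]_n) : b <> 0 -> 0 < dual_norm nu b.
Proof.
move=> b0; pose v := (nu b)^-1 *: b.
have nub : 0 < nu b.
  rewrite lt_neqAle is_norm_ge0 andbT; apply/negP => /eqP/esym.
  by move/(is_norm_definite nu_norm).
have bb : 0 < dotv b b.
  rewrite /dotv mxE lt_neqAle sumr_ge0 => [|i _]; last by rewrite mxE -expr2 sqr_ge0.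
  rewrite andbT eq_sym psumr_neq0; last by move=> i _; rewrite mxE -expr2 sqr_ge0.
  apply/hasP; apply: contrapT => H; apply: b0; apply/matrixP => i j.
  rewrite ord1 mxE; apply/eqP; apply: contrapT => /negP bi; apply: H.
  exists i; rewrite ?mem_index_enum//= mxE -expr2 lt_neqAle sqr_ge0 andbT.
  by rewrite eq_sym sqrf_eq0.
apply: (@lt_le_trans _ _ (dotv b v)).
  by rewrite /dotv /v -scalemxAr mxE mulr_gt0// invr_gt0.
apply: sup_upper_bound; first exact: has_sup_dual_norm.
exists v => //=; rewrite (is_norm_scale nu_norm) normfV gtr0_norm// mulVf//.
exact: lt0r_neq0.
Qed.

(* Scale a direction attaining the supremum D = dual_norm nu b up to
   z = e D^2 / (h + e D), the solution of h / (D - z) = h / D + e. *)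
Lemma dual_norm_projection (b : 'cV[R]_n) (h e : R) : b <> 0 -> 0 <= h -> 0 < e ->
  exists2 v, dotv b v = h & nu v <= h / dual_norm nu b + e.
Proof.
move=> b0 h0 e0; have D0 := dual_norm_gt0 b b0; set D := dual_norm nu b in D0 *.
have : 0 < e * D ^+ 2 / (h + e * D).
  by have := mulr_gt0 e0 D0; move=> ?; rewrite divr_gt0 ?mulr_gt0 ?exprn_gt0//; lra.
move=> /sup_adherent /(_ (has_sup_dual_norm b)) [_ [v /= v1 <-]].
rewrite -/(dual_norm nu b) -/D => Dv.
have eD := mulr_gt0 e0 D0.
have heD : 0 < h + e * D by lra.
have E : D - e * D ^+ 2 / (h + e * D) = h * D / (h + e * D).
  by field; rewrite lt0r_neq0.
rewrite E in Dv.
have bv0 : 0 < dotv b v.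
  by apply: le_lt_trans Dv; rewrite divr_ge0 ?mulr_ge0// ltW.
exists ((h / dotv b v) *: v).
  by rewrite /dotv -scalemxAr mxE -/(dotv b v) divfK// lt0r_neq0.
rewrite (is_norm_scale nu_norm) ger0_norm ?divr_ge0 ?(ltW bv0)//.
apply: (@le_trans _ _ (h / dotv b v)).
  by rewrite ler_piMr// divr_ge0// ltW.
rewrite ler_pdivrMr//.
have -> : h / D + e = (h + e * D) / D by field; rewrite lt0r_neq0.
rewrite mulrAC ler_pdivlMr// mulrC [leRHS]mulrC -ler_pdivrMr//.
by rewrite mulrC ltW// mulrC.
Qed.

End norm_theory.

(** * Finitely supported probability measures *)

Section discrete_measure.
Context (R : realType) (d : measure_display) (T : measurableType d).
Context (I : finType) (w : I -> R) (y : I -> T).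
Hypotheses (w_ge0 : forall i, 0 <= w i) (w_sum1 : \sum_i w i = 1).

(* The proof arguments only serve to infer the probability structure. *)
Definition discrete (_ : forall i, 0 <= w i) (_ : \sum_i w i = 1) (A : set T) : \bar R :=
  (\sum_i (w i)%:E * \d_(y i) A)%E.
Local Notation mu := (discrete w_ge0 w_sum1).

Let discrete0 : mu set0 = 0%E.
Proof. by rewrite /discrete big1// => i _; rewrite measure0 mule0. Qed.

Let discrete_ge0 A : (0 <= mu A)%E.
Proof. by rewrite sume_ge0// => i _; rewrite mule_ge0// lee_fin. Qed.

Let discrete_semi_sigma_additive : semi_sigma_additive mu.
Proof.
move=> F mF tF mUF; rewrite /discrete.
rewrite [X in X @ _ --> _](_ : _ = fun m =>
    (\sum_i (w i)%:E * \sum_(0 <= j < m) \d_(y i) (F j))%E); last first.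
  apply/funext => m; rewrite exchange_big/=; apply: eq_bigr => i _.
  by rewrite ge0_sume_distrr.
apply: cvg_nnesum => i _.
  by apply: nearW => m; rewrite mule_ge0 ?lee_fin// sume_ge0.
by apply: cvgeZl => //; exact: measure_semi_sigma_additive.
Qed.

HB.instance Definition _ := isMeasure.Build _ _ _ mu
  discrete0 discrete_ge0 discrete_semi_sigma_additive.

Let discrete_setT : mu setT = 1%E.
Proof.
rewrite /discrete (eq_bigr (fun i => (w i)%:E)).
  by rewrite sumEFin w_sum1.
by move=> i _; rewrite probability_setT mule1.
Qed.

HB.instance Definition _ := Measure_isProbability.Build _ _ _ mu discrete_setT.

Lemma discreteE A : mu A = (\sum_i w i * (y i \in A)%:R)%:E.
Proof. by rewrite -sumEFin; apply: eq_bigr => i _; rewrite diracE. Qed.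

Import HBNNSimple.

(* Measurability of f is not assumed, which is why only one inequality holds. *)
Lemma integral_discrete_le (f : T -> R) : (forall x, 0 <= f x) ->
  (\int[mu]_x (f x)%:E <= (\sum_i w i * f (y i))%:E)%E.
Proof.
move=> f_ge0; rewrite ge0_integralTE; last by move=> x; rewrite lee_fin.
apply: ge_ereal_sup => _ [h /= hf <-].
have -> : sintegral mu h = (\sum_i w i * h (y i))%:E.
  rewrite sintegralE fsbig_finite//=.
  under eq_bigr do rewrite discreteE -EFinM mulr_sumr.
  rewrite sumEFin exchange_big/=; congr EFin; apply: eq_bigr => i _.
  (* Integrating [h] against the Dirac measure at [y i] expands [h (y i)] over the values of [h],
     matching the terms of [sintegral]. *)
  have := @integral_dirac _ T (y i) R setT measurableT (EFin \o h).
  rewrite diracT mul1e integralT_nnsfun sintegralE fsbig_finite//=.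
  under eq_bigr do rewrite diracE -EFinM.
  have mh : measurable_fun [set: T] (EFin \o h) by exact/measurable_EFinP.
  rewrite sumEFin => /(_ mh) [] <-.
  rewrite mulr_sumr; by apply: eq_bigr => z _; rewrite mulrCA.
rewrite lee_fin ler_sum// => i _; rewrite ler_wpM2l//.
by have := hf (y i); rewrite lee_fin.
Qed.

End discrete_measure.
Arguments discrete {R d T I w} y.

(** * Moving part of the mass of each sample *)

Section mass_transport.
Context (R : realType) (n N : nat) (N_gt0 : (0 < N)%N).
Context (nu : 'cV[R]_n -> R) (nu_norm : is_norm nu).
Context (xi y : 'I_N -> 'cV[R]_n) (p : 'I_N -> R).
Hypothesis p01 : forall i, 0 <= p i <= 1.

(* Left summands carry the mass that moves from xi i to y i, right summands the
   mass that stays at xi i. *)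
Let w (j : 'I_N + 'I_N) : R :=
  N%:R^-1 * match j with inl i => p i | inr i => 1 - p i end.
Let source (j : 'I_N + 'I_N) : borelcV R n :=
  match j with inl i => xi i | inr i => xi i end.
Let target (j : 'I_N + 'I_N) : borelcV R n :=
  match j with inl i => y i | inr i => xi i end.

Let w_ge0 j : 0 <= w j.
Proof.
rewrite mulr_ge0 ?invr_ge0//.
by case: j => i; have /andP[? ?] := p01 i; rewrite ?subr_ge0.
Qed.

Let w_sum1 : \sum_j w j = 1.
Proof.
rewrite big_sumType/= -big_split/=.
rewrite (eq_bigr (fun=> N%:R^-1)) => [|i _]; last by rewrite /w; ring.
by rewrite sumr_const card_ord -[LHS]mulr_natl mulfV// pnatr_eq0 -lt0n.
Qed.

(** The joint law of [source] and [target] couples the empirical measure with [Q], the law of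
    [target]; mass that stays costs nothing. *)
Lemma ambiguity_mass_transport (theta : R) :
  N%:R^-1 * \sum_i p i * nu (xi i - y i) <= theta ->
  exists2 Q, ambiguity nu (empirical N_gt0 xi) theta Q &
    forall A, Q A =
      (N%:R^-1 * \sum_i (p i * (y i \in A)%:R + (1 - p i) * (xi i \in A)%:R))%:E.
Proof.
move=> cost.
exists (discrete target w_ge0 w_sum1 : probability (borelcV R n) R); last first.
  move=> A; rewrite /= discreteE big_sumType/= -big_split/= mulr_sumr.
  by congr EFin; apply: eq_bigr => i _; rewrite /w; ring.
pose Pi : probability (borelcV R n * borelcV R n)%type R :=
  discrete (fun j => (source j, target j)) w_ge0 w_sum1.
have PiE A B : Pi (A `*` B) =
    (\sum_j w j * ((source j \in A) && (target j \in B))%:R)%:E.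
  rewrite /Pi/= discreteE; congr EFin; apply: eq_bigr => j _; congr (_ * _%:R).
  by congr nat_of_bool; exact: (classical_sets.in_setX (source j, target j)).
apply: (@le_trans _ _ (\int[Pi]_z
    (nu ((z.1 : 'cV[R]_n) - (z.2 : 'cV[R]_n)))%:E)%E).
  apply: ereal_inf_lbound; exists Pi => //; split => A _.
    rewrite PiE /= /empirical.
    under [in RHS]eq_bigr do rewrite diracE.
    rewrite sumEFin -EFinM big_sumType/= -big_split/= mulr_sumr.
    by congr EFin; apply: eq_bigr => i _; rewrite !in_setT !andbT /w; ring.
  rewrite PiE /= [RHS]discreteE; congr EFin.
  by apply: eq_bigr => j _; rewrite in_setT.
(* An upper bound on the cost of this one coupling suffices, the distance being an infimum. *)
apply: le_trans (integral_discrete_le _ _ _ _ _ _ _ _ _ _) _.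
  by move=> z; exact: is_norm_ge0.
rewrite lee_fin (le_trans _ cost)// big_sumType/= [X in _ + X]big1.
  by rewrite addr0 mulr_sumr ler_sum// => i _; rewrite /w mulrA.
by move=> i _; rewrite subrr is_norm0// mulr0.
Qed.

End mass_transport.

(** * Order statistics by counting *)

Section kth_largest_count.
Context (R : realType) (N k : nat) (v : 'I_N -> R).
Hypothesis kN : (k < N)%N.
Let s := sort >=%O [seq v i | i <- enum 'I_N].

Let count_s (f : pred R) : count f s = (\sum_(i < N) f (v i))%N.
Proof.
rewrite /s count_sort count_map -sum1_count big_enum_cond/= big_mkcond/=.
by apply: eq_bigr => i _; case: (f _).
Qed.

Let size_s : size s = N.
Proof. by rewrite size_sort size_map size_enum_ord. Qed.

Let nth_s (i j : nat) : (i <= j < N)%N -> s`_j <= s`_i.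
Proof.
move=> /andP[ij jN].
have ge_tr : transitive (>=%O : rel R) by move=> a b c ab bc; exact: le_trans bc ab.
apply: (sorted_leq_nth ge_tr (@lexx _ R) 0) => //.
- by apply: sort_sorted => a b; exact: le_total.
- by rewrite inE size_s (leq_ltn_trans ij).
- by rewrite inE size_s.
Qed.

(** The first [k.+1] entries of the decreasing list are at least the entry at index [k]. *)
Lemma kth_largest_count_ge :
  (k < \sum_(i < N) (kth_largest k v <= v i)%R)%N.
Proof.
rewrite -count_s -(cat_take_drop k.+1 s) count_cat ltn_addr//.
have : all (>= kth_largest k v) (take k.+1 s).
  apply/(all_nthP 0) => i; rewrite size_takel ?size_s// => ik.
  by rewrite nth_take// nth_s// kN andbT -ltnS.
by rewrite all_count => /eqP ->; rewrite size_takel ?size_s.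
Qed.

(** From index [k] on, no entry exceeds the one at index [k]. *)
Lemma kth_largest_count_gt :
  (\sum_(i < N) (kth_largest k v < v i)%R <= k)%N.
Proof.
rewrite -count_s -(cat_take_drop k s) count_cat.
have /eqP -> : count (> kth_largest k v) (drop k s) == 0%N.
  rewrite -leqn0 leqNgt -has_count; apply/negP => /(has_nthP 0)[i].
  rewrite size_drop size_s ltn_subRL => ikN.
  by rewrite nth_drop ltNge nth_s// leq_addr.
by rewrite addn0 (leq_trans (count_size _ _))// size_takel// size_s ltnW.
Qed.

Lemma kth_largest_le c :
  (\sum_(i < N) (c < v i)%R <= k)%N -> kth_largest k v <= c.
Proof.
move=> ck; rewrite leNgt; apply/negP => cq.
have := leq_ltn_trans ck kth_largest_count_ge; rewrite ltnNge => /negP; apply.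
apply: leq_sum => i _.
by have [qi|//] := leP (kth_largest k v) (v i); rewrite (lt_le_trans cq qi).
Qed.

End kth_largest_count.

(** * The fractional knapsack bound *)

Lemma truncn_mul_lt (R : realType) (N : nat) (eps : R) :
  (0 < N)%N -> 0 <= eps -> eps < 1 -> (Num.truncn (eps * N%:R) < N)%N.
Proof.
move=> N_gt0 eps_ge0 eps_lt1; have N0 : 0 < N%:R :> R by rewrite ltr0n.
have /truncn_itv/andP[kE _] : 0 <= eps * N%:R by rewrite mulr_ge0// ltW.
by rewrite -(ltr_nat R) (le_lt_trans kE)// -[ltRHS]mul1r ltr_pM2r.
Qed.

(** Linear programming duality: [m * t - \sum_i Num.max (t - s i) 0] bounds from below the cost of
    moving mass [m], with equality for this [t] when [k <= m <= k.+1]. The negations turn largest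
    into smallest. *)
Lemma knapsack_kth_smallest (R : realType) (N : nat) (s : 'I_N -> R) (eps theta : R)
    (t := - kth_largest (Num.truncn (eps * N%:R)) (fun i => - s i)) :
  (0 < N)%N -> 0 <= eps -> eps < 1 -> (forall i, 0 <= s i) ->
  (forall p : 'I_N -> R, (forall i, 0 <= p i <= 1) ->
    N%:R^-1 * \sum_i p i * s i < theta -> N%:R^-1 * \sum_i p i <= eps) ->
  theta + N%:R^-1 * \sum_i Num.max (t - s i) 0 <= eps * t.
Proof.
move=> N_gt0 eps_ge0 eps_lt1 s_ge0 budget; set k := Num.truncn _ in t *.
set rs := \sum_i _.
have N0 : 0 < N%:R :> R by rewrite ltr0n.
have E_ge0 : 0 <= eps * N%:R by rewrite mulr_ge0// ltW.
have /andP[kE Ek] : k%:R <= eps * N%:R < k.+1%:R by exact: truncn_itv.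
(* Index [k] lies inside the sorted list, so [kth_largest] is not the default value of [nth]. *)
have kN : (k < N)%N by exact: truncn_mul_lt.
(* Samples strictly below the threshold and samples tied at it; [cA <= k < k.+1 <= cA + cB] leaves
   room for a fractional share of the ties. *)
pose cA := \sum_i ((s i < t)%R : nat)%:R : R.
pose cB := \sum_i ((s i == t)%R : nat)%:R : R.
have cA_k : cA <= k%:R.
  rewrite /cA -natr_sum ler_nat.
  apply: leq_trans (kth_largest_count_gt _ _ _ (fun i => - s i) kN).
  by apply: leq_sum => i _; rewrite /t ltrNr.
have cAB_k : k.+1%:R <= cA + cB.
  rewrite /cA /cB -!natr_sum -natrD ler_nat -big_split/=.
  apply: leq_trans (kth_largest_count_ge _ _ _ (fun i => - s i) kN) _.
  apply: leq_sum => i _; rewrite lerNr -/t.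
  by case: ltgtP.
have t_ge0 : 0 <= t.
  rewrite oppr_ge0; apply: kth_largest_le => //.
  rewrite big1// => i _; apply/eqP; rewrite eqb0 -leNgt.
  by rewrite oppr_le0.
rewrite leNgt; apply/negP => lt_theta.
have eta_gt0 : 0 < N%:R * theta + rs - eps * N%:R * t.
  have : N%:R * (eps * t) < N%:R * (theta + N%:R^-1 * rs) by rewrite ltr_pM2l.
  by rewrite mulrDr mulVKf ?lt0r_neq0//; lra.
set eta := (X in 0 < X) in eta_gt0.
(* The excess over [eps * N%:R] is small enough to keep [m <= k.+1] and to cost less than the slack
   [eta]; the denominator [t + 1] stays positive at [t = 0]. *)
pose m := eps * N%:R + Num.min (k.+1%:R - eps * N%:R) (eta / (t + 1)).
have Em : eps * N%:R < m.
  by rewrite ltrDl lt_min subr_gt0 Ek divr_gt0//; lra.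
have mk : m <= k.+1%:R by rewrite -lerBrDl ge_min lexx.
have mt : m * t < N%:R * theta + rs.
  have : Num.min (k.+1%:R - eps * N%:R) (eta / (t + 1)) * t < eta.
    apply: (@le_lt_trans _ _ (eta / (t + 1) * t)).
      by rewrite ler_wpM2r// ge_min lexx orbT.
    by rewrite mulrAC ltr_pdivrMr; [nra | lra].
  by rewrite /m /eta mulrDl; lra.
have k1 : k.+1%:R = k%:R + 1 :> R by rewrite -natr1.
have cB_gt0 : 0 < cB by lra.
(* All tied samples move the same fraction, chosen to bring the total mass to [m]. *)
pose al := (m - cA) / cB.
have al01 : 0 <= al <= 1.
  apply/andP; split; first by rewrite divr_ge0 ?(ltW cB_gt0)//; lra.
  by rewrite ler_pdivrMr//; lra.
pose p i : R := ((s i < t)%R : nat)%:R + al * ((s i == t)%R : nat)%:R.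
have pE : \sum_i p i = m.
  by rewrite big_split/= -mulr_sumr -/cA -/cB /al divfK ?lt0r_neq0//; ring.
have psE : \sum_i p i * s i = m * t - rs.
  rewrite -pE mulr_suml -sumrB; apply: eq_bigr => i _; rewrite /p.
  case: (ltgtP (s i) t) => [lt|lt|->] /=.
  - by rewrite max_l; [ring | rewrite subr_ge0 ltW].
  - by rewrite max_r; [ring | rewrite subr_le0 ltW].
  - by rewrite subrr maxxx; ring.
have /budget : forall i, 0 <= p i <= 1.
  by move=> i; rewrite /p; case: ltgtP => _; rewrite ?mulr1 ?mulr0 ?addr0 ?add0r ?lexx ?ler01.
rewrite pE psE => /(_ _); rewrite mulrC ltr_pdivrMr// => H.
have : m / N%:R <= eps by rewrite mulrC H//; lra.
by rewrite ler_pdivrMr//; lra.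
Qed.

(** * Distance to the unsafe half-spaces, and assembly of the certificate *)

Lemma halfspace_projection (R : realType) (n : nat) (nu : 'cV[R]_n -> R)
    (b xi : 'cV[R]_n) (c e : R) : is_norm nu -> b <> 0 -> 0 < e ->
  exists2 y, dotv b y + c <= 0 &
    nu (xi - y) <= Num.max ((dotv b xi + c) / dual_norm nu b) 0 + e.
Proof.
move=> nu_norm b0 e0; have D0 := dual_norm_gt0 _ _ _ nu_norm _ b0.
(* A point already in the half-space stays put; otherwise it is shifted by [- v] onto the bounding
   hyperplane, which is unsafe since [safety_set] uses strict inequalities. *)
have [h0|/ltW h0] := leP (dotv b xi + c) 0.
  exists xi => //; rewrite subrr is_norm0// addr_ge0 ?(ltW e0)// le_max.
  by rewrite lexx orbT.
have [v bv nuv] := dual_norm_projection _ _ _ nu_norm _ _ _ b0 h0 e0.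
exists (xi - v).
  have -> : dotv b (xi - v) = dotv b xi - dotv b v.
    by rewrite /dotv mulmxBr !mxE.
  by rewrite bv; lra.
rewrite opprB addrC subrK max_l// divr_ge0// ltW//.
Qed.

Theorem proposition1 (R : realType) (K L N P : nat)
    (K_gt0 : (0 < K)%N) (L_gt0 : (0 < L)%N)
    (N_gt0 : (0 < N)%N) (P_gt0 : (0 < P)%N)
    (X : set 'cV[R]_L) (X_compact : compact X)
    (nu : 'cV[R]_K -> R) (nu_norm : is_norm nu)
    (xi : 'I_N -> 'cV[R]_K)
    (eps : R) (eps_gt0 : 0 < eps) (eps_lt1 : eps < 1)
    (theta : R) (theta_gt0 : 0 < theta)
    (a : 'I_P -> 'cV[R]_L) (b : 'I_P -> 'cV[R]_K) (d : 'I_P -> R)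
    (b_neq0 : forall p, b p <> 0)
    (M : R) (M_gt0 : 0 < M)
    (M_large : forall x, X x -> forall (i : 'I_N) (p : 'I_P),
      `|dotv (b p) (xi i) + d p - dotv (a p) x| / dual_norm nu (b p) <= M)
    (x : 'cV[R]_L)
    (x_feasible : feasible_DR X nu N_gt0 xi eps theta (safety_set a b d) x) :
  let k : nat := Num.truncn (eps * N%:R) in
  let q (p : 'I_P) : R := kth_largest k (fun i => - dotv (b p) (xi i)) in
  exists (r : 'I_N -> R) (t : R) (z : 'I_N -> bool),
    [/\ [/\ 0 <= t,
            forall i, 0 <= r i,
            eps * t >= theta + N%:R^-1 * \sum_(i < N) r i &
            forall i, M * (1 - (z i)%:R) >= t - r i],
        (\sum_(i < N) z i <= k)%N,
        forall (i : 'I_N) (p : 'I_P),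
          (dotv (b p) (xi i) + d p - dotv (a p) x) / dual_norm nu (b p)
          + (- dotv (b p) (xi i) - q p) / dual_norm nu (b p) * (z i)%:R
          >= t - r i &
        forall p : 'I_P,
          (- q p + d p - dotv (a p) x) / dual_norm nu (b p) - t >= 0].
Proof.
move=> k q; case: x_feasible => Xx sup_le.
pose D p := dual_norm nu (b p).
have D_gt0 p : 0 < D p by exact: (dual_norm_gt0 _ _ _ nu_norm).
pose w i p := (dotv (b p) (xi i) + d p - dotv (a p) x) / D p.
(* The unsafe set is a union of half-spaces; the least [w i p] belongs to the nearest one. *)
have [pm pmP] : exists pm, forall i p, w i (pm i) <= w i p.
  exists (fun i => [arg min_(p < Ordinal P_gt0) w i p]%O) => i p.
  by case: arg_minP => // p0 _; apply.
pose s i := Num.max (w i (pm i)) 0.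
have s_ge0 i : 0 <= s i by rewrite le_max lexx orbT.
(* Positivity matters: when [s i = 0], some [w i p] may be negative. *)
have s_le i p : 0 < s i -> s i <= w i p.
  by rewrite /s; have [_|_ _] := leP (w i (pm i)) 0; [rewrite ltxx | exact: pmP].
have near i e : 0 < e -> exists y, (~` safety_set a b d x) y /\ nu (xi i - y) <= s i + e.
  move=> e0; have [y yS ydist] := @halfspace_projection R K nu (b (pm i)) (xi i)
    (d (pm i) - dotv (a (pm i)) x) e nu_norm (b_neq0 _) e0.
  exists y; split; last by move: ydist; rewrite addrA.
  by move=> /(_ (pm i)); rewrite -addrA ltNge yS.
have budget (m : 'I_N -> R) : (forall i, 0 <= m i <= 1) ->
    N%:R^-1 * \sum_i m i * s i < theta -> N%:R^-1 * \sum_i m i <= eps.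
  (* The unspent budget serves as projection error; weights at most 1 keep the average extra cost
     within [e]. *)
  move=> m01 cost; pose e := theta - N%:R^-1 * \sum_i m i * s i.
  have e0 : 0 < e by rewrite subr_gt0.
  have /choice[y yP] : forall i, exists y, (~` safety_set a b d x) y /\
      nu (xi i - y) <= s i + e by move=> i; exact: near.
  have [|Q Qamb QE] := ambiguity_mass_transport _ _ _ N_gt0 _ nu_norm xi y m m01 theta.
    apply: (@le_trans _ _ (N%:R^-1 * \sum_i (m i * s i + e))).
      rewrite ler_wpM2l ?invr_ge0// ler_sum// => i _.
      have /andP[mi0 mi1] := m01 i.
      apply: (@le_trans _ _ (m i * (s i + e))).
        by rewrite ler_wpM2l//; case: (yP i).
      by rewrite mulrDr lerD2l ler_piMl// ltW.
    rewrite big_split/= sumr_const card_ord -[e *+ N]mulr_natl mulrDr mulKf.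
      by rewrite addrC subrK.
    by rewrite pnatr_eq0 -lt0n.
  have : (Q (~` safety_set a b d x : set (borelcV R K)) <= eps%:E)%E.
    by apply: le_trans sup_le; apply: ereal_sup_ubound; exists Q.
  rewrite QE lee_fin; apply: le_trans.
  (* Every [y i] is unsafe, so moved mass counts fully; unmoved mass can only add. *)
  rewrite ler_wpM2l ?invr_ge0// ler_sum// => i _.
  have /andP[mi0 mi1] := m01 i.
  rewrite mem_set ?mulr1; last by case: (yP i).
  by rewrite lerDl mulr_ge0// subr_ge0.
have kN : (k < N)%N by apply: truncn_mul_lt => //; exact: ltW.
have := knapsack_kth_smallest _ _ _ _ theta N_gt0 (ltW eps_gt0) eps_lt1 s_ge0 budget.
set t := - kth_largest _ _; rewrite -/k => main.
pose r i := Num.max (t - s i) 0.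
have r_ge0 i : 0 <= r i by rewrite le_max lexx orbT.
(* Strictness comes from [theta > 0]; it makes [t <= s i] imply [0 < s i], as [s_le] requires. *)
have t_gt0 : 0 < t.
  rewrite -(pmulr_rgt0 _ eps_gt0) (lt_le_trans _ main)//.
  by rewrite ltr_pwDl// mulr_ge0 ?invr_ge0// sumr_ge0// => i _; exact: r_ge0.
have tr_le i : t - r i <= s i.
  have : t - s i <= r i by rewrite le_max lexx.
  by lra.
have few : (\sum_(i < N) (s i < t)%R <= k)%N.
  apply: leq_trans (kth_largest_count_gt _ _ _ (fun i => - s i) kN).
  by apply: leq_sum => i _; rewrite /t ltrNr.
have u_ge0 p : (- q p + d p - dotv (a p) x) / D p - t >= 0.
  rewrite subr_ge0 ler_pdivlMr//.
  suff : q p <= d p - dotv (a p) x - t * D p by lra.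
  (* A value [- dotv (b p) (xi i)] above the bound means [w i p < t], which forces [s i < t]; [few]
     limits such indices to [k]. *)
  apply: kth_largest_le => //; apply: leq_trans few.
  apply: leq_sum => i _; have [_|ts] := ltP (s i) t; first exact: leq_b1.
  rewrite leqn0 eqb0 -leNgt.
  have := le_trans ts (s_le i p (lt_le_trans t_gt0 ts)).
  by rewrite /w ler_pdivlMr//; lra.
(* Where [s i = 0], already [t - r i <= 0]; elsewhere [s i] is a lower bound for every [w i p], and
   [M] dominates the smallest of them. *)
exists r, t, (fun i => s i == 0); split.
- split=> [||//|i]; [exact: ltW|exact: r_ge0|].
  apply: le_trans (tr_le i) _; have [->|si] := eqVneq (s i) 0.
    by rewrite subrr mulr0.
  rewrite subr0 mulr1; have si0 : 0 < s i by rewrite lt_neqAle eq_sym si s_ge0.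
  apply: le_trans (s_le i (pm i) si0) _.
  apply: le_trans (M_large x Xx i (pm i)).
  by rewrite ler_pM2r ?invr_gt0// ler_norm.
- apply: leq_trans few; apply: leq_sum => i _.
  by have [->|//] := eqVneq (s i) 0; rewrite t_gt0.
- move=> i p; apply: le_trans (tr_le i) _; have [->|si] := eqVneq (s i) 0.
    (* For [z i = 1] the sample terms cancel, leaving the quotient that [u_ge0] bounds below by
       [t > 0]. *)
    rewrite mulr1 -mulrDl divr_ge0 ?(ltW (D_gt0 p))//.
    have : t <= (- q p + d p - dotv (a p) x) / D p by rewrite -subr_ge0.
    rewrite ler_pdivlMr// => h; have := mulr_gt0 t_gt0 (D_gt0 p); lra.
  rewrite mulr0 addr0; apply: s_le.
  by rewrite lt_neqAle eq_sym si s_ge0.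
- exact: u_ge0.
Qed.
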